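(* Let $E := L^0(\mathbb{C},\mu)$ be the topological vector space of equivalence classes of measurable functions $\mathbb{C}\to\mathbb{C}$ (modulo functions vanishing $\mu$-almost everywhere) with the topology of convergence in measure, where $\mu$ is the Gauss measure on $\mathbb{C}=\mathbb{R}^2$, and let $f\colon \mathbb{C}\to E$, $f(z):=\mathbf{1}_{A(z)}$, where $A(z):=\{w\in\mathbb{C} : \operatorname{Re}(w)\le \operatorname{Re}(z)\text{ and }\operatorname{Im}(w)\le\operatorname{Im}(z)\}$. Consider $E$ as a real topological vector space. Then $g:=f|_{\mathbb{R}}\colon\mathbb{R}\to E$ is an injective $C^\infty_{\mathbb{R}}$-curve whose derivative $g'$ vanishes identically.
   Context: Gauss measure: $d\nu(x)=\frac{1}{\sqrt{\pi}}e^{-x^2}\,dx$ on $\mathbb{R}$ and $\mu:=\nu\otimes\nu$ on $\mathbb{C}=\mathbb{R}^2$. Topology on $E=L^0(\mathbb{C},\mu)$: a basis of open zero-neighbourhoods is given by the sets $W_k$, $k\in\mathbb{N}$, consisting of the classes of measurable $\gamma\colon\mathbb{C}\to\mathbb{C}$ with $\mu(\{z\in\mathbb{C}: |\gamma(z)|\ge \frac1k\})<\frac1k$. For measurable $A\subseteq\mathbb{C}$, $\mathbf{1}_A$ denotes (the class of) the characteristic function of $A$. Differentiability classes: let $\mathbb{K}$ be a non-discrete topological field (here $\mathbb{K}=\mathbb{R}$), $U\subseteq\mathbb{K}$ open, $E$ a Hausdorff topological $\mathbb{K}$-vector space and $f\colon U\to E$ a map. $f$ is of class $C^0_{\mathbb{K}}$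 if it is continuous; then $f^{<0>}:=f$. Recursively, for $k\in\mathbb{N}$, $f$ is of class $C^k_{\mathbb{K}}$ if it is of class $C^{k-1}_{\mathbb{K}}$ and there is a continuous map $f^{<k>}\colon U^{k+1}\to E$ such that $$f^{<k>}(x_1,\ldots,x_{k+1})=\frac{1}{x_1-x_2}\left(f^{<k-1>}(x_1,x_3,\ldots,x_{k+1})-f^{<k-1>}(x_2,x_3,\ldots,x_{k+1})\right)$$ for all $(x_1,\ldots,x_{k+1})\in U^{k+1}$ with $x_1\ne x_2$ (such $f^{<k>}$ is unique). $f$ is of class $C^\infty_{\mathbb{K}}$ if it is of class $C^k_{\mathbb{K}}$ for all $k\in\mathbb{N}_0$. The derivative of a $C^1_{\mathbb{K}}$-map is $f'(x)=f^{<1>}(x,x)$. A $C^k_{\mathbb{R}}$-curve is a map of class $C^k_{\mathbb{R}}$ defined on an open subset of $\mathbb{R}$. *)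

(* Defs.v *)
(* MathComp-Analysis *)
From HB Require Import structures.
From mathcomp Require Import all_boot all_order all_algebra.
From mathcomp Require Import complex.
From mathcomp Require Import generic_quotient.
From mathcomp Require Import all_classical all_reals all_analysis.
From mathcomp Require Import measurable_realfun.
From mathcomp Require Import ring lra.

Set Implicit Arguments.
Unset Strict Implicit.
Unset Printing Implicit Defensive.

Import Order.TTheory GRing.Theory Num.Theory.
Import numFieldNormedType.Exports.
Import ComplexField.Normc.

Local Open Scope classical_set_scope.
Local Open Scope ring_scope.

Section divided_differences.
Context {K : numFieldType} {E : topologicalLmodType K}.

Definition cube (U : set K) k : set 'rV[K]_k := [set x | forall j, U (x 0 j)].
Arguments cube : clear implicits.

(* In [x = (x_1, ..., x_{k+2})] the coordinates are numbered from 0, so that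
   [col' 1 x = (x_1, x_3, ..., x_{k+2})] and
   [col' 0 x = (x_2, x_3, ..., x_{k+2})]. *)
Definition is_next_divdiff (U : set K) k (h : 'rV[K]_k.+1 -> E)
    (g : 'rV[K]_k.+2 -> E) : Prop :=
  {within cube U k.+2, continuous g} /\
  (forall x : 'rV[K]_k.+2, cube U k.+2 x -> x 0 0 != x 0 1 ->
    g x = (x 0 0 - x 0 1)^-1 *: (h (col' 1 x) - h (col' 0 x))).

(* Maps on [U] are represented by total maps, of which only the restriction to
   [U] matters. [divdiff U f k] is [f^{<k>}], chosen among the continuous extensions whenever one exists; its
   values on [cube U k.+1] do not depend on the choice if [U] is open and [E]
   is Hausdorff (see [is_next_divdiff_unique]). *)
Fixpoint divdiff (U : set K) (f : K -> E) (k : nat) : 'rV[K]_k.+1 -> E :=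
  if k is k'.+1 then xget (fun=> 0) (is_next_divdiff U (@divdiff U f k'))
  else fun x => f (x 0 0).
Arguments divdiff : clear implicits.

Fixpoint classC (U : set K) (f : K -> E) (k : nat) : Prop :=
  if k is k'.+1 then
    classC U f k' /\ exists g, is_next_divdiff U (divdiff U f k') g
  else {within U, continuous f}.

Definition classCinfty (U : set K) (f : K -> E) := forall k, classC U f k.

(* [f'(x) = f^{<1>}(x, x)] *)
Definition dderive (U : set K) (f : K -> E) (x : K) : E :=
  divdiff U f 1 (const_mx x).

Lemma is_next_divdiff_unique (U : set K) k (h : 'rV[K]_k.+1 -> E) g1 g2 :
  open U -> hausdorff_space E -> is_next_divdiff U h g1 ->
  is_next_divdiff U h g2 -> {in cube U k.+2, g1 =1 g2}.
Proof.
move=> oU hE [c1 e1] [c2 e2] x /set_mem Ux.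
have oC : open (cube U k.+2).
  rewrite openE => y Uy; exists (fun _ j => U) => [i j|z hz j].
    by apply: open_nbhs_nbhs; split => //; rewrite (ord1 i).
  exact: hz.
have [x01|x01] := eqVneq (x 0 0) (x 0 1); last by rewrite e1 ?e2.
pose p (t : K) : 'rV[K]_k.+2 := \row_j (if j == 0 then x 0 0 + t else x 0 j).
have px0 : p 0 = x.
  by apply/rowP => j; rewrite mxE; case: eqP => // ->; rewrite addr0.
have cp : p t @[t --> (0 : K)^'] --> x.
  apply: cvg_within_filter => A [P Px PA].
  have H j : \forall t \near (0 : K), P 0 j (p t 0 j).
    have [->|j0] := eqVneq j 0; last first.
      apply: (@filterE _ (nbhs (0 : K))) => t; rewrite mxE (negbTE j0).
      exact: nbhs_singleton (Px 0 j).
    have [e e0 eP] : exists2 e : K, 0 < e & ball (x 0 0) e `<=` P 0 0.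
      exact/nbhs_ballP/(Px 0 0).
    exists e => // t /=; rewrite sub0r normrN => te; apply: eP.
    by rewrite /ball/= mxE eqxx opprD addrA subrr sub0r normrN.
  have : \forall t \near (0 : K), forall j, P 0 j (p t 0 j).
    by apply: filter_forall H.
  by apply: filterS => t Pt; apply: PA => i j; rewrite (ord1 i).
have F (g : 'rV[K]_k.+2 -> E) : {within cube U k.+2, continuous g} ->
    g (p t) @[t --> (0 : K)^'] --> g x.
  rewrite continuous_open_subspace// => /(_ x (mem_set Ux)) cg.
  exact: cvg_comp cp cg.
have G : g2 (p t) @[t --> (0 : K)^'] --> g1 x.
  apply: cvg_trans (F g1 c1); apply: near_eq_cvg.
  have : \forall t \near (0 : K)^', cube U k.+2 (p t).
    by have := cp (cube U k.+2); apply; apply: open_nbhs_nbhs; split.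
  have : \forall t \near (0 : K)^', t != 0 by apply: withinT.
  apply: filterS2 => t t0 Ut.
  have pt : p t 0 0 != p t 0 1.
    by rewrite !mxE/= x01 -subr_eq0 addrAC subrr add0r.
  by rewrite e1// e2.
exact: (cvg_unique hE G (F g2 c2)).
Qed.

End divided_differences.
Arguments cube {K} U k.
Arguments divdiff {K E} U f k.

HB.instance Definition _ (R : realType) := isPointed.Build R[i] 0.

Definition C_display : measure_display. Proof. exact default_measure_display. Qed.

Section complex_measurable.
Context {R : realType}.

Definition toR2 (z : R[i]) : R * R := (complex.Re z, complex.Im z).
Definition ofR2 (p : R * R) : R[i] := (p.1 +i* p.2)%C.

(* The product sigma-algebra of [R * R], i.e. the Borel sets of the plane,
   transported to [R[i]]. *)
Definition C_measurable : set_system R[i] :=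
  preimage_set_system setT toR2 measurable.

Let mC0 : C_measurable set0.
Proof. by exists set0 => //; rewrite preimage_set0 setI0. Qed.

Let mCC A : C_measurable A -> C_measurable (~` A).
Proof.
move=> [B mB <-]; exists (~` B); first exact: measurableC.
by rewrite !setTI preimage_setC.
Qed.

Let mCU (F : (set R[i])^nat) : (forall i, C_measurable (F i)) ->
  C_measurable (\bigcup_i F i).
Proof.
move=> mF.
have /choice[G HG] : forall n, exists B, measurable B /\ setT `&` toR2 @^-1` B = F n.
  by move=> n; have [B mB] := mF n; exists B.
exists (\bigcup_n G n); first by apply: bigcupT_measurable => n; apply: (HG n).1.
by rewrite setTI preimage_bigcup; apply: eq_bigcupr => n _; rewrite -(HG n).2 setTI.
Qed.

HB.instance Definition _ := isMeasurable.Build C_display R[i] mC0 mCC mCU.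

Lemma measurable_toR2 : measurable_fun setT toR2.
Proof. by move=> _ B mB; exists B. Qed.

Lemma measurable_ofR2 : measurable_fun setT ofR2.
Proof.
move=> _ A [B mB <-]; rewrite !setTI.
by have -> : ofR2 @^-1` (toR2 @^-1` B) = B by apply/seteqP; split => -[].
Qed.

Section mfunC.
Context d (T : measurableType d).
Implicit Types f g : T -> R[i].

Lemma measurable_funC f : measurable_fun setT f <->
  measurable_fun setT (fun w => complex.Re (f w)) /\
  measurable_fun setT (fun w => complex.Im (f w)).
Proof.
split.
  move=> mf; have m2 : measurable_fun setT (toR2 \o f).
    by apply: measurableT_comp => //; exact: measurable_toR2.
  by split; [apply: (measurableT_comp measurable_fst m2)
           |apply: (measurableT_comp measurable_snd m2)].
move=> [mr mi].
have -> : f = ofR2 \o (fun w => (complex.Re (f w), complex.Im (f w))).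
  by apply/funext => w /=; rewrite /ofR2/=; case: (f w).
apply: measurableT_comp; first exact: measurable_ofR2.
exact: measurable_fun_pair.
Qed.

Lemma measurable_addC f g : measurable_fun setT f -> measurable_fun setT g ->
  measurable_fun setT (f \+ g).
Proof.
move=> /measurable_funC[fr fi] /measurable_funC[gr gi].
apply/measurable_funC; split.
- rewrite (_ : (fun w => _) = (fun w => complex.Re (f w)) \+ (fun w => complex.Re (g w))).
    exact: measurable_funD.
  by apply/funext => w /=; case: (f w); case: (g w).
- rewrite (_ : (fun w => _) = (fun w => complex.Im (f w)) \+ (fun w => complex.Im (g w))).
    exact: measurable_funD.
  by apply/funext => w /=; case: (f w); case: (g w).
Qed.

Lemma measurable_scaleC (a : R) f : measurable_fun setT f ->
  measurable_fun setT (fun w => a%:C%C * f w).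
Proof.
move=> /measurable_funC[fr fi].
apply/measurable_funC; split.
- rewrite (_ : (fun w => _) = (fun w => a * complex.Re (f w))).
    exact: measurable_funM.
  by apply/funext => w /=; case: (f w) => x y /=; rewrite mul0r subr0.
- rewrite (_ : (fun w => _) = (fun w => a * complex.Im (f w))).
    exact: measurable_funM.
  by apply/funext => w /=; case: (f w) => x y /=; rewrite mul0r addr0.
Qed.

Lemma measurable_indicC (A : set T) : measurable A ->
  measurable_fun setT (\1_A : T -> R[i]).
Proof.
move=> mA; apply/measurable_funC; split.
- rewrite (_ : (fun w => _) = \1_A); first exact: measurable_indic.
  by apply/funext => w /=; rewrite !indicE; case: (_ \in _).
- rewrite (_ : (fun w => _) = cst 0); first exact: measurable_cst.
  by apply/funext => w /=; rewrite !indicE; case: (_ \in _).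
Qed.

Lemma measurable_normC f : measurable_fun setT f ->
  measurable_fun setT (fun w => normc (f w)).
Proof.
move=> /measurable_funC[fr fi].
rewrite (_ : (fun w => _) =
  (fun w => Num.sqrt (complex.Re (f w) ^+ 2 + complex.Im (f w) ^+ 2))).
  have ms : measurable_fun setT (@Num.sqrt R).
    by apply: continuous_measurable_fun; exact: sqrt_continuous.
  apply: (measurableT_comp ms).
  by apply: measurable_funD; apply: measurable_funX.
by apply/funext => w /=; case: (f w).
Qed.

Lemma measurable_normC_ge f (r : R) : measurable_fun setT f ->
  measurable [set w | r <= normc (f w)].
Proof.
move=> /measurable_normC mf.
rewrite -[X in measurable X]setTI.
exact: (measurable_fun_le measurableT (measurable_cst r) mf).
Qed.

End mfunC.
End complex_measurable.

Section L0_def.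
Local Open Scope quotient_scope.
Context d (T : measurableType d) (R : realType).
Variable mu : {finite_measure set T -> \bar R}.

Let aeI (P Q : T -> Prop) : {ae mu, forall w, P w} -> {ae mu, forall w, Q w} ->
  {ae mu, forall w, P w /\ Q w}.
Proof. by apply: filterS2 => w. Qed.

Definition L0 : Type := {mfun_ mu, T >-> R[i]}.

HB.instance Definition _ := Choice.on L0.
HB.instance Definition _ := EqQuotient.on L0.

(* A chosen representative of the class. *)
Definition L0_fun (f : L0) : T -> R[i] := repr f.
Coercion L0_fun : L0 >-> Funclass.

Definition L0_class (h : T -> R[i]) (mh : measurable_fun setT h) : L0 :=
  \pi_L0 (mfun_Sub (mem_set mh : h \in mfun)).

Lemma measurable_L0 (f : L0) : measurable_fun setT f.
Proof. exact: measurable_funPT. Qed.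

Lemma L0_classE h mh : {ae mu, forall w, @L0_class h mh w = h w}.
Proof.
rewrite /L0_class /L0_fun.
set m := mfun_Sub _.
have /eqmodP/asboolP : repr (\pi_L0 m) = m %[mod L0] by rewrite reprK.
by apply: filterS => w /(_ I).
Qed.

Lemma L0_eqP (f g : L0) : {ae mu, forall w, f w = g w} <-> f = g.
Proof.
split=> [fg|->]; last exact: aeW.
rewrite -[f]reprK -[g]reprK; apply/eqmodP/asboolP.
by apply: filterS fg => w + _.
Qed.

Definition L0_zero : L0 := L0_class (@measurable_cst _ _ T R[i] setT 0).
Definition L0_scale (a : R) (f : L0) : L0 :=
  L0_class (measurable_scaleC a (measurable_L0 f)).
Definition L0_add (f g : L0) : L0 :=
  L0_class (measurable_addC (measurable_L0 f) (measurable_L0 g)).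
Definition L0_opp (f : L0) : L0 := L0_scale (- 1) f.

Lemma L0_zeroE : {ae mu, forall w, L0_zero w = 0}.
Proof. exact: L0_classE. Qed.
Lemma L0_addE f g : {ae mu, forall w, L0_add f g w = f w + g w}.
Proof. exact: L0_classE. Qed.
Lemma L0_scaleE a f : {ae mu, forall w, L0_scale a f w = (a%:C)%C * f w}.
Proof. exact: L0_classE. Qed.
Lemma L0_oppE f : {ae mu, forall w, L0_opp f w = - f w}.
Proof.
by apply: filterS (L0_scaleE (-1) f) => w ->; rewrite rmorphN mulN1r.
Qed.

Lemma L0_addA : associative L0_add.
Proof.
move=> f g h; apply/L0_eqP.
have H := aeI (L0_addE f (L0_add g h)) (L0_addE g h).
by apply: filterS3 H (L0_addE (L0_add f g) h) (L0_addE f g)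
  => w [-> ->] -> ->; rewrite addrA.
Qed.

Lemma L0_addC : commutative L0_add.
Proof.
move=> f g; apply/L0_eqP.
by apply: filterS2 (L0_addE f g) (L0_addE g f) => w -> ->; rewrite addrC.
Qed.

Lemma L0_add0 : left_id L0_zero L0_add.
Proof.
move=> f; apply/L0_eqP.
by apply: filterS2 (L0_addE L0_zero f) L0_zeroE => w -> ->; rewrite add0r.
Qed.

Lemma L0_addN : left_inverse L0_zero L0_opp L0_add.
Proof.
move=> f; apply/L0_eqP.
apply: filterS3 (L0_addE (L0_opp f) f) (L0_oppE f) L0_zeroE => w -> -> ->.
by rewrite addNr.
Qed.

HB.instance Definition _ := GRing.isZmodule.Build L0
  L0_addA L0_addC L0_add0 L0_addN.

Lemma L0_scaleA a b v : L0_scale a (L0_scale b v) = L0_scale (a * b) v.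
Proof.
apply/L0_eqP.
apply: filterS3 (L0_scaleE a (L0_scale b v)) (L0_scaleE b v)
   (L0_scaleE (a * b) v) => w -> -> ->.
by rewrite rmorphM mulrA.
Qed.

Lemma L0_scale1 : left_id 1 L0_scale.
Proof.
move=> f; apply/L0_eqP.
by apply: filterS (L0_scaleE 1 f) => w ->; rewrite rmorph1 mul1r.
Qed.

Lemma L0_scaleDr : right_distributive L0_scale +%R.
Proof.
move=> a f g; apply/L0_eqP.
have H := aeI (L0_addE (L0_scale a f) (L0_scale a g)) (L0_addE f g).
have H' := aeI (L0_scaleE a f) (L0_scaleE a g).
apply: filterS3 H (L0_scaleE a (f + g)) H' => w [].
rewrite -[f + g]/(L0_add f g) -[X in _ = L0_fun X w]/(L0_add _ _).
by move=> -> h -> [-> ->]; rewrite h mulrDr.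
Qed.

Lemma L0_scaleDl v : {morph L0_scale^~ v : a b / a + b}.
Proof.
move=> a b; apply/L0_eqP.
have H := aeI (L0_scaleE a v) (L0_scaleE b v).
apply: filterS3 (L0_addE (L0_scale a v) (L0_scale b v))
   (L0_scaleE (a + b) v) H => w.
rewrite -[X in _ = L0_fun X w]/(L0_add _ _).
by move=> -> -> [-> ->]; rewrite rmorphD mulrDl.
Qed.

HB.instance Definition _ := GRing.Zmodule_isLmodule.Build R L0
  L0_scaleA L0_scale1 L0_scaleDr L0_scaleDl.

Lemma L0_DE (f g : L0) : {ae mu, forall w, (f + g : L0) w = f w + g w}.
Proof. exact: L0_addE. Qed.
Lemma L0_ZE a (f : L0) : {ae mu, forall w, (a *: f : L0) w = (a%:C)%C * f w}.
Proof. exact: L0_scaleE. Qed.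
Lemma L0_0E : {ae mu, forall w, (0 : L0) w = 0}.
Proof. exact: L0_zeroE. Qed.

(* [W_{k+1}]; the set does not depend on the representative of [f]. *)
Definition L0_ball0 (k : nat) : set L0 :=
  [set f : L0 | (mu [set w | (k.+1%:R^-1 <= normc (f w))%R] <
     (k.+1%:R^-1)%:E)%E].

Definition L0_nbhs (f : L0) : set_system L0 :=
  filter_from setT (fun k => [set g | L0_ball0 k (g - f)]).

HB.instance Definition _ := hasNbhs.Build L0 L0_nbhs.

Let level (f : L0) (r : R) := [set w | r <= normc (f w)].

Let mlevel f r : measurable (level f r).
Proof. exact: measurable_normC_ge (measurable_L0 f). Qed.

Let le_mu_ae (A B : set T) : measurable A -> measurable B ->
  {ae mu, forall w, A w -> B w} -> (mu A <= mu B)%E.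
Proof.
move=> mA mB [N [mN N0 AN]].
have AB : A `<=` B `|` N.
  move=> w Aw; case: (pselect (B w)) => Bw; [by left|right].
  by apply: AN => /(_ Aw).
have N0' : mu N = 0%E := N0.
have h : (mu (B `|` N) <= mu B + mu N)%E by exact: measureU2.
rewrite N0' adde0 in h; apply: le_trans h.
by apply: le_measure; rewrite ?inE//; exact: measurableU.
Qed.

Lemma L0_ball0_0 k : L0_ball0 k 0.
Proof.
rewrite /L0_ball0/=; apply: (@le_lt_trans _ _ (mu set0)).
  apply: le_mu_ae => //; first exact: mlevel.
  by apply: filterS L0_0E => w e /=; rewrite e normc0 leNgt invr_gt0 ltr0n.
by rewrite measure0 lte_fin invr_gt0 ltr0n.
Qed.

Lemma L0_ball0_mono m n : (m <= n)%N -> L0_ball0 n `<=` L0_ball0 m.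
Proof.
move=> mn f; rewrite /L0_ball0/= => fn.
have h : n.+1%:R^-1 <= m.+1%:R^-1 :> R.
  by rewrite lef_pV2 ?posrE ?ltr0n// ler_nat ltnS.
apply: (@le_lt_trans _ _ (mu (level f n.+1%:R^-1))).
  apply: le_measure; rewrite ?inE; [exact: mlevel|exact: mlevel|].
  by move=> w; rewrite /level/=; exact: le_trans.
by apply: (lt_le_trans fn); rewrite lee_fin.
Qed.

Lemma L0_ball0D k f g :
  L0_ball0 k.*2.+1 f -> L0_ball0 k.*2.+1 g -> L0_ball0 k (f + g).
Proof.
rewrite /L0_ball0/=.
have -> : k.*2.+2%:R = 2 * k.+1%:R :> R by rewrite -natrM mul2n doubleS.
set r := k.+1%:R^-1 : R.
rewrite invfM -/r => hf hg.
have -> : r%:E = ((2^-1 * r)%:E + (2^-1 * r)%:E)%E.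
  by rewrite -EFinD -mulrDl; congr EFin; field.
apply: le_lt_trans (lteD hf hg).
apply: (@le_trans _ _ (mu (level f (2^-1 * r) `|` level g (2^-1 * r)))); last first.
  by apply: measureU2; exact: mlevel.
apply: le_mu_ae; [exact: mlevel|by apply: measurableU; exact: mlevel|].
apply: filterS (L0_DE f g) => w e; rewrite /level/= e => rfg.
case: (leP (2^-1 * r) (normc (f w))) => [|h1]; first by left.
case: (leP (2^-1 * r) (normc (g w))) => [|h2]; first by right.
have := le_normcD (f w) (g w) => h3; clear hf hg e; exfalso; lra.
Qed.

Lemma normc_real (a : R) : normc (a%:C)%C = `|a|.
Proof. by rewrite /= expr0n/= addr0 sqrtr_sqr. Qed.

Lemma L0_ball0Z (M : nat) k (a : R) f : (0 < M)%N -> `|a| <= M%:R ->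
  L0_ball0 (M * k.+1).-1 f -> L0_ball0 k (a *: f).
Proof.
move=> M0 aM; rewrite /L0_ball0/= prednK ?muln_gt0 ?M0// => hf.
have MR : 0 < M%:R :> R by rewrite ltr0n.
apply: (@le_lt_trans _ _ (mu (level f (M * k.+1)%:R^-1))).
  apply: le_mu_ae; [exact: mlevel|exact: mlevel|].
  apply: filterS (L0_ZE a f) => w e; rewrite /level/= e normcM normc_real.
  rewrite natrM invfM => h.
  rewrite mulrC ler_pdivrMr// mulrC; apply: (le_trans h).
  by apply: ler_wpM2r => //; case: (L0_fun f w) => x y /=; exact: sqrtr_ge0.
apply: (lt_le_trans hf); rewrite lee_fin lef_pV2 ?posrE ?ltr0n ?muln_gt0 ?M0//.
by rewrite ler_nat leq_pmull.
Qed.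

Lemma L0_ball0N k f : L0_ball0 k f -> L0_ball0 k (- f).
Proof.
move=> hf; rewrite -scaleN1r; apply: (@L0_ball0Z 1%N) => //.
  by rewrite normrN normr1.
by rewrite mul1n.
Qed.

Lemma L0_absorb (f : L0) k :
  exists2 e : R, 0 < e & forall a, `|a| <= e -> L0_ball0 k (a *: f).
Proof.
pose F n := level f n%:R.
have F0 : \bigcap_n F n = set0.
  apply/seteqP; split => // w Fw.
  have [n hn] : exists n : nat, normc (f w) < n%:R.
    exists (Num.bound (normc (f w))); apply: le_lt_trans (archi_boundP _).
      exact: lexx.
    by case: (L0_fun f w) => x y /=; exact: sqrtr_ge0.
  by have := Fw n I; rewrite /F/level/= leNgt hn.
have cF : mu \o F @ \oo --> mu (\bigcap_n F n).
  apply: nonincreasing_cvg_mu.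
  - by rewrite -ge0_fin_numE//; exact: fin_num_measure (mlevel _ _).
  - by move=> n; exact: mlevel.
  - by rewrite F0.
  - apply/nonincreasing_seqP => n; apply/subsetPset => w; rewrite /F/level/=.
    by apply: le_trans; rewrite ler_nat.
rewrite F0 measure0 in cF.
have kp : 0 < k.+1%:R^-1 :> R by rewrite invr_gt0 ltr0n.
have [m _ hm] : \forall n \near \oo, (mu (F n) < (k.+1%:R^-1)%:E)%E.
  by apply: (cF [set y | (y < _)%E]); apply: open_ereal_lt'; rewrite lte_fin.
pose e : R := (k.+1%:R * m.+1%:R)^-1.
have e0 : 0 < e by rewrite invr_gt0 mulr_gt0 ?ltr0n.
exists e => // a ae; rewrite /L0_ball0/=.
apply: (le_lt_trans _ (hm m.+1 (leqnSn m))).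
apply: le_mu_ae; [exact: mlevel|exact: mlevel|].
apply: filterS (L0_ZE a f) => w afw; rewrite /F /level/= afw normcM normc_real => h.
have : k.+1%:R^-1 <= e * normc (f w).
  apply: (le_trans h); apply: ler_wpM2r => //.
  by case: (L0_fun f w) => x y /=; exact: sqrtr_ge0.
by rewrite /e invfM -mulrA -[X in X <= _]mulr1 ler_pM2l// mulrC ler_pdivlMr ?ltr0n// mul1r.
Qed.

Let nbhs_filter (f : L0) : ProperFilter (nbhs f).
Proof.
apply: filter_from_proper; last first.
  by move=> k _; exists f; rewrite /= subrr; exact: L0_ball0_0.
apply: filter_from_filter; first by exists 0%N.
move=> i j _ _; exists (maxn i j) => // g /= h; split.
  exact: L0_ball0_mono (leq_maxl i j) _ h.
exact: L0_ball0_mono (leq_maxr i j) _ h.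
Qed.

Let nbhs_singl (f : L0) (A : set L0) : nbhs f A -> A f.
Proof. by move=> [k _]; apply; rewrite /= subrr; exact: L0_ball0_0. Qed.

Let nbhs_nbhs' (f : L0) (A : set L0) : nbhs f A -> nbhs f (nbhs^~ A).
Proof.
move=> [k _ kA]; exists k.*2.+1 => // g /= gf; exists k.*2.+1 => // h /= hg.
apply: kA => /=; rewrite -(subrK g h) -addrA.
exact: L0_ball0D.
Qed.

HB.instance Definition _ := Nbhs_isNbhsTopological.Build L0
  nbhs_filter nbhs_singl nbhs_nbhs'.

Let L0_add_continuous : continuous (fun x : L0 * L0 => x.1 + x.2).
Proof.
move=> [f g] A [k _ kA].
exists ([set f' : L0 | L0_ball0 k.*2.+1 (f' - f)], [set g' : L0 | L0_ball0 k.*2.+1 (g' - g)]).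
  by split; exists k.*2.+1.
move=> [f' g'] /= [hf hg]; apply: kA => /=.
by rewrite opprD addrACA; exact: L0_ball0D.
Qed.

HB.instance Definition _ :=
  PreTopologicalNmodule_isTopologicalNmodule.Build L0 L0_add_continuous.

Let L0_scale_continuous : continuous (fun z : R^o * L0 => z.1 *: z.2).
Proof.
move=> [a f] A [k _ kA].
have [e e0 he] := L0_absorb f k.*2.+1.
pose M := (Num.bound (`|a| + e)).+1.
exists ([set b : R^o | `|a - b| < e],
  [set g : L0 | L0_ball0 (M * k.*2.+2).-1 (g - f)]).
  by split; [exists e|exists (M * k.*2.+2).-1].
move=> [b g] /= [ab gf]; apply: kA => /=.
have -> : b *: g - a *: f = b *: (g - f) + (b - a) *: f.
  by rewrite scalerBr scalerBl addrA subrK.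
apply: L0_ball0D; last by apply: he; rewrite distrC ltW.
apply: (@L0_ball0Z M) => //.
have h1 : `|b| <= `|a| + e.
  rewrite -(subrK a b) addrC; apply: (le_trans (ler_normD _ _)).
  by rewrite lerD2l distrC ltW.
have h2 : `|a| + e < (Num.bound (`|a| + e))%:R.
  by apply: archi_boundP; rewrite addr_ge0// ltW.
apply: (le_trans h1); apply: (le_trans (ltW h2)); by rewrite ler_nat.
Qed.

HB.instance Definition _ :=
  TopologicalNmodule_isTopologicalLmodule.Build R L0 L0_scale_continuous.

Lemma L0_hausdorff : hausdorff_space L0.
Proof.
move=> f g fg; apply/eqP; rewrite -subr_eq0; apply/eqP.
have H k : L0_ball0 k (f - g).
  have [h /= [h1 h2]] : [set h | L0_ball0 k.*2.+1 (h - f)] `&`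
     [set h | L0_ball0 k.*2.+1 (h - g)] !=set0.
    by apply: fg; exists k.*2.+1.
  rewrite -(subrK h f) -addrA; apply: L0_ball0D => //.
  by rewrite -opprB; exact: L0_ball0N.
set u : L0 := f - g in H *.
have N n : mu (level u n.+1%:R^-1) = 0%E.
  apply/eqP; rewrite eq_le measure_ge0 andbT.
  apply/lee_addgt0Pr => e e0; rewrite add0e.
  pose m := maxn n (Num.bound e^-1).
  have mn : m.+1%:R^-1 <= n.+1%:R^-1 :> R.
    by rewrite lef_pV2 ?posrE ?ltr0n// ler_nat ltnS leq_maxl.
  have me : m.+1%:R^-1 <= e.
    rewrite -[e]invrK lef_pV2 ?posrE ?invr_gt0 ?ltr0n//.
    apply/ltW; apply: (lt_le_trans (archi_boundP _)); first by rewrite invr_ge0 ltW.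
    by rewrite ler_nat; apply: leqW; exact: leq_maxr.
  apply: (@le_trans _ _ (mu (level u m.+1%:R^-1))).
    apply: le_measure; rewrite ?inE; [exact: mlevel|exact: mlevel|].
    by move=> w; rewrite /level/=; exact: le_trans.
  by apply: (le_trans (ltW (H m))); rewrite lee_fin.
apply/L0_eqP.
have Z : {ae mu, forall w, u w = 0}.
  have : mu.-negligible (\bigcup_n level u n.+1%:R^-1).
    by apply: negligible_bigcup => n; apply/negligibleP; [exact: mlevel|exact: N].
  apply: negligibleS.
  - move=> w /= uw.
    have u0 : 0 < normc (u w).
      rewrite lt_neqAle; apply/andP; split.
        by apply/eqP => /esym/eq0_normc.
      by case: (L0_fun u w) => x y /=; exact: sqrtr_ge0.
    exists (Num.bound (normc (u w))^-1) => //; rewrite /level/=.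
    rewrite -[leRHS]invrK lef_pV2 ?posrE ?invr_gt0 ?ltr0n//.
    apply/ltW; apply: (lt_le_trans (archi_boundP _)); first by rewrite invr_ge0 ltW.
    by rewrite ler_nat.
by apply: filterS2 Z L0_0E => w -> ->.
Qed.

(* The [L0_ball0 k] form a basis of neighbourhoods of [0] by definition of the
   topology; they are moreover open. *)
Lemma open_L0_ball0 k : open (L0_ball0 k).
Proof.
suff nbhsk (f : L0) : L0_ball0 k f -> L0_nbhs f (L0_ball0 k).
  by rewrite openE => f /nbhsk.
rewrite /L0_ball0/= => fk.
set r := k.+1%:R^-1 in fk *.
pose F n := level f (r - n.+1%:R^-1).
have FE : \bigcap_n F n = level f r.
  apply/seteqP; split => w; last first.
    by move=> rw n _; apply: le_trans rw; rewrite gerBl invr_ge0 ler0n.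
  move=> Fw; rewrite /level/= leNgt; apply/negP => wr.
  have d0 : 0 < r - normc (f w) by rewrite subr_gt0.
  pose n := Num.bound (r - normc (f w))^-1.
  have : n.+1%:R^-1 < r - normc (f w).
    rewrite -[ltRHS]invrK ltf_pV2 ?posrE ?invr_gt0 ?ltr0n//.
    apply: (lt_le_trans (archi_boundP _)); first by rewrite invr_ge0 ltW.
    by rewrite ler_nat.
  by rewrite ltrBrDr addrC -ltrBrDr ltNge (Fw n I).
have cF : mu \o F @ \oo --> mu (\bigcap_n F n).
  apply: nonincreasing_cvg_mu.
  - by rewrite -ge0_fin_numE//; exact: fin_num_measure (mlevel _ _).
  - by move=> n; exact: mlevel.
  - by rewrite FE; exact: mlevel.
  - apply/nonincreasing_seqP => n; apply/subsetPset => w; rewrite /F/level/=.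
    apply: le_trans; rewrite lerD2l lerN2 lef_pV2 ?posrE ?ltr0n//.
    by rewrite ler_nat.
rewrite FE in cF.
have fn : mu (level f r) \is a fin_num by exact: fin_num_measure (mlevel _ _).
pose m := fine (mu (level f r)).
have mE : mu (level f r) = m%:E by rewrite /m fineK.
have mr : m < r by rewrite -lte_fin -mE.
rewrite mE in cF.
have [N _ hN] : \forall n \near \oo, (mu (F n) < ((m + r) / 2)%:E)%E.
  apply: (cF [set y | (y < _)%E]); apply: open_ereal_lt'; rewrite lte_fin.
  exact: (midf_lt mr).1.
pose n := maxn N (Num.bound ((r - m) / 2)^-1).
have rm : 0 < (r - m) / 2 by rewrite divr_gt0// subr_gt0.
have nr : n.+1%:R^-1 <= (r - m) / 2.
  rewrite -[leRHS]invrK lef_pV2 ?posrE ?invr_gt0 ?ltr0n//.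
  apply/ltW; apply: (lt_le_trans (archi_boundP _)); first by rewrite invr_ge0 ltW.
  by rewrite ler_nat; apply: leqW; exact: leq_maxr.
exists n => // g /= gf.
have rE : r%:E = (((m + r) / 2)%:E + ((r - m) / 2)%:E)%E.
  by rewrite -EFinD; congr EFin; field.
rewrite [X in (_ < X)%E]rE.
apply: (@le_lt_trans _ _ (mu (F n) + mu (level (g - f)%R n.+1%:R^-1))%E); last first.
  apply: lteD; first by apply: hN; exact: leq_maxl.
  by apply: (lt_le_trans gf); rewrite lee_fin.
apply: (@le_trans _ _ (mu (F n `|` level (g - f) n.+1%:R^-1))); last first.
  by apply: measureU2; exact: mlevel.
apply: le_mu_ae; [exact: mlevel|by apply: measurableU; exact: mlevel|].
apply: filterS (L0_DE (g - f) f) => w; rewrite subrK /F /level/= => e.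
rewrite e => rfg.
case: (leP (r - n.+1%:R^-1) (normc (f w))) => [|h1]; first by left.
case: (leP n.+1%:R^-1 (normc ((g - f : L0) w))) => [|h2]; first by right.
have := le_normcD ((g - f : L0) w) (f w) => h3.
have := ltrD h2 h1.
by rewrite [ltRHS]addrC subrK ltNge (le_trans rfg h3).
Qed.

End L0_def.

Section gauss_measure.
Context (R : realType).

Definition gauss1 (A : set R) : \bar R :=
  (\int[lebesgue_measure]_(x in A) ((Num.sqrt pi)^-1 * expR (- x ^+ 2))%:E)%E.

Let dens_ge0 (x : R) : 0 <= (Num.sqrt pi)^-1 * expR (- x ^+ 2) :> R.
Proof. by rewrite mulr_ge0 ?invr_ge0 ?sqrtr_ge0 ?expR_ge0. Qed.

Let integrable_dens : (@lebesgue_measure R).-integrable [set: R]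
  (fun x => ((Num.sqrt pi)^-1 * expR (- x ^+ 2))%:E).
Proof.
under eq_fun do rewrite EFinM.
apply: integrableZl => //; exact: integrableT_gauss.
Qed.

Let gauss1_0 : gauss1 set0 = 0%E.
Proof. by rewrite /gauss1 integral_set0. Qed.

Let gauss1_ge0 A : (0 <= gauss1 A)%E.
Proof. by apply: integral_ge0 => x _; rewrite lee_fin. Qed.

Let gauss1_sigma_additive : semi_sigma_additive gauss1.
Proof.
move=> /= A mA tA mUA; rewrite /gauss1/= integral_bigcup//=; last first.
  exact: (integrableS _ _ (subsetT _) integrable_dens).
apply: is_cvg_ereal_nneg_natsum_cond => n _ _.
by apply: integral_ge0 => /= x ?; rewrite lee_fin.
Qed.

HB.instance Definition _ := isMeasure.Build _ _ _
  gauss1 gauss1_0 gauss1_ge0 gauss1_sigma_additive.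

Let gauss1_setT : gauss1 [set: _] = 1%E.
Proof.
rewrite /gauss1; under eq_integral do rewrite EFinM.
rewrite integralZl//=; last exact: integrableT_gauss.
by rewrite integralT_gauss -EFinM mulVf// gt_eqF// sqrtr_gt0 pi_gt0.
Qed.

HB.instance Definition _ :=
  @Measure_isProbability.Build _ _ R gauss1 gauss1_setT.

(* [R[i]] is identified with [R * R] through [ofR2]. *)
Definition gauss2 : set R[i] -> \bar R :=
  pushforward (gauss1 \x gauss1)%E (@ofR2 R).

Let gauss2_0 : gauss2 set0 = 0%E.
Proof. by rewrite /gauss2 /pushforward preimage_set0 measure0. Qed.

Let gauss2_ge0 A : (0 <= gauss2 A)%E.
Proof. exact: integral_ge0. Qed.

Let mof (A : set R[i]) : measurable A -> measurable (@ofR2 R @^-1` A).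
Proof. by move=> mA; rewrite -[X in measurable X]setTI; exact: measurable_ofR2. Qed.

Let gauss2_sigma_additive : semi_sigma_additive gauss2.
Proof.
move=> F mF tF mUF; rewrite /gauss2 /pushforward preimage_bigcup.
apply: measure_semi_sigma_additive.
- by move=> n; exact: mof.
- apply/trivIsetP => /= i j _ _ ij; rewrite -preimage_setI.
  by move/trivIsetP : tF => /(_ _ _ _ _ ij) ->//; rewrite preimage_set0.
- by rewrite -preimage_bigcup; exact: mof.
Qed.

HB.instance Definition _ := isMeasure.Build _ _ _
  gauss2 gauss2_0 gauss2_ge0 gauss2_sigma_additive.

Let gauss2_setT : gauss2 [set: _] = 1%E.
Proof.
rewrite /gauss2 /pushforward preimage_setT -setXTT.
transitivity (gauss1 setT * gauss1 setT)%E; first exact: product_measure1E.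
by rewrite gauss1_setT mule1.
Qed.

HB.instance Definition _ :=
  @Measure_isProbability.Build _ _ R gauss2 gauss2_setT.

Definition quadrant (z : R[i]) : set R[i] :=
  [set w | complex.Re w <= complex.Re z /\ complex.Im w <= complex.Im z].

Lemma measurable_quadrant z : measurable (quadrant z).
Proof.
exists (`]-oo, complex.Re z]%classic `*` `]-oo, complex.Im z]%classic).
  by apply: measurableX; exact: measurable_itv.
by rewrite setTI; apply/seteqP; split => w /=; rewrite !in_itv.
Qed.

Definition quadrant_curve (z : R[i]) : L0 gauss2 :=
  L0_class gauss2 (measurable_indicC (measurable_quadrant z)).

End gauss_measure.

(* Main.v *)
(* For all x_0, ..., x_k and almost every w, [g^{<k>}(x_0, ..., x_k)(w)] has to
   be the divided difference at the nodes x_i of the function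
   t |-> 1_{A(t)}(w), which is locally constant off t = Re w.  It depends on w
   only through J = {i | w \in A(x_i)}: it is the leading coefficient of the
   polynomial H of degree at most k with H = 1 modulo \prod_(i in J) (X - x_i)
   and H = 0 modulo \prod_(i notin J) (X - x_i).  This also makes sense when
   nodes coincide, satisfies the recursion for any two distinct nodes, and, for
   fixed J, is continuous in the nodes.  Moving the nodes slightly changes J
   only for w in a set of small measure, whence continuity into L^0.  At (x, x)
   the set J is empty or full, H is constant, and the derivative is 0. *)
Require Import Defs.
From mathcomp Require Import all_boot all_order all_algebra.
From mathcomp Require Import complex.
From mathcomp Require Import all_classical all_reals all_analysis.
From mathcomp Require Import measurable_realfun.
From mathcomp Require Import ring lra.

Set Implicit Arguments.
Unset Strict Implicit.
Unset Printing Implicit Defensive.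

Import Order.TTheory GRing.Theory Num.Theory.
Import numFieldNormedType.Exports.
Import ComplexField.Normc.

Local Open Scope classical_set_scope.
Local Open Scope ring_scope.

(** * Interpolation of 0-1 data at possibly coinciding nodes *)

Section indicator_interpolation.
Context {F : fieldType}.

Definition nodal_poly n (J : {set 'I_n}) (x : 'rV[F]_n) : {poly F} :=
  \prod_(i in J) ('X - (x 0 i)%:P).

(** This makes the two moduli in [interpolates] coprime. Nodes on the same side may coincide. *)
Definition separates n (J : {set 'I_n}) (x : 'rV[F]_n) : Prop :=
  forall i j, i \in J -> j \notin J -> x 0 i != x 0 j.

Definition interpolates n (J : {set 'I_n}) (x : 'rV[F]_n) (H : {poly F}) :=
  [&& (size H <= n)%N, nodal_poly J x %| H - 1 & nodal_poly (~: J)%SET x %| H].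

(* The leading coefficient of the interpolation polynomial is the divided
   difference at [x] of any locally constant function equal to [1] at the
   [x_i], [i \in J], and to [0] at the other nodes. *)
Definition interp_divdiff n (J : {set 'I_n}) (x : 'rV[F]_n) : F :=
  (xget 0 [set H | interpolates J x H])`_n.-1.

Definition lift_set n (j : 'I_n.+1) (J : {set 'I_n.+1}) : {set 'I_n} :=
  [set k | lift j k \in J]%SET.

Lemma size_nodal_poly n (J : {set 'I_n}) x : size (nodal_poly J x) = #|J|.+1.
Proof. by rewrite /nodal_poly -big_enum size_prod_XsubC -cardE. Qed.

Lemma monic_nodal_poly n (J : {set 'I_n}) x : nodal_poly J x \is monic.
Proof. exact: monic_prod_XsubC. Qed.

Lemma nodal_polyM n (J : {set 'I_n}) x :
  nodal_poly J x * nodal_poly (~: J)%SET x = nodal_poly [set: 'I_n]%SET x.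
Proof.
rewrite [RHS](bigID (mem J))/=; congr (_ * _); apply: eq_bigl => i.
  by rewrite inE.
by rewrite !inE.
Qed.

Lemma lift_setC n j (J : {set 'I_n.+1}) :
  lift_set j (~: J)%SET = (~: lift_set j J)%SET.
Proof. by apply/setP => k; rewrite !inE. Qed.

Lemma lift_setT n (j : 'I_n.+1) : lift_set j [set: 'I_n.+1]%SET = [set: 'I_n]%SET.
Proof. by apply/setP => k; rewrite !inE. Qed.

Lemma nodal_poly_lift n j (J : {set 'I_n.+1}) x : j \in J ->
  nodal_poly J x = ('X - (x 0 j)%:P) * nodal_poly (lift_set j J) (col' j x).
Proof.
move=> jJ; rewrite /nodal_poly (bigD1_ord j)//=; congr (_ * _).
by apply: eq_big => k; [rewrite inE|rewrite mxE].
Qed.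

Lemma dvdp_nodal_poly_lift n j (J : {set 'I_n.+1}) x :
  nodal_poly (lift_set j J) (col' j x) %| nodal_poly J x.
Proof.
have [jJ|jJ] := boolP (j \in J).
  by rewrite (nodal_poly_lift _ jJ) dvdp_mull.
rewrite /nodal_poly [X in _ %| X]big_mkcond/= (bigD1_ord j)//= (negbTE jJ) mul1r.
rewrite -big_mkcond/= [X in _ %| X](eq_big (mem (lift_set j J))
  (fun k => 'X - (col' j x 0 k)%:P))// => k; rewrite ?inE// => _.
by rewrite mxE.
Qed.

Lemma separates_lift n j (J : {set 'I_n.+1}) x :
  separates J x -> separates (lift_set j J) (col' j x).
Proof. by move=> sx a b; rewrite !inE !mxE => aJ bJ; exact: sx. Qed.

Lemma coprimep_nodal_poly n (J : {set 'I_n}) x : separates J x ->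
  coprimep (nodal_poly J x) (nodal_poly (~: J)%SET x).
Proof.
move=> sx.
rewrite /nodal_poly; apply: (big_ind (fun p => coprimep p _)).
- exact: coprime1p.
- by move=> p q cp cq; rewrite coprimepMl cp.
move=> i iJ; apply: (big_ind (fun p => coprimep _ p)).
- exact: coprimep1.
- by move=> p q cp cq; rewrite coprimepMr cp.
move=> j; rewrite inE => jJ; apply: coprimep_XsubC2.
by rewrite subr_eq0 eq_sym; exact: sx.
Qed.

(** Chinese remainders: if [u * A + v * B = 1], then [v * B] is 1 modulo [A] and 0 modulo [B].
    Reducing it modulo [A * B], which has degree [n], gives the size bound. *)
Lemma interpolates_exists n (J : {set 'I_n}) x : separates J x ->
  exists H, interpolates J x H.
Proof.
move=> /coprimep_nodal_poly/Bezout_eq1_coprimepP[[u v]/= uv].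
set A := nodal_poly J x in uv; set B := nodal_poly _ x in uv.
have AB : A * B = nodal_poly [set: 'I_n]%SET x by exact: nodal_polyM.
exists (v * B %% (A * B)); apply/and3P.
have E : v * B %% (A * B) = v * B - (v * B %/ (A * B)) * (A * B).
  by rewrite {2}(divp_eq (v * B) (A * B)) addrAC subrr add0r.
split.
- rewrite -ltnS; have := @ltn_modp _ (v * B) (A * B).
  rewrite AB size_nodal_poly cardsT card_ord => ->.
  exact/monic_neq0/monic_nodal_poly.
- rewrite E -uv [X in _ %| X](_ : _ = A * (- u - v * B %/ (A * B) * B)).
    exact: dvdp_mulr.
  ring.
- rewrite E [X in _ %| X](_ : _ = (v - v * B %/ (A * B) * A) * B).
    exact: dvdp_mull.
  ring.
Qed.

(** No degree bound is imposed on [G] and [H], so that this also compares an interpolation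
    polynomial with the one for fewer nodes. *)
Lemma dvdp_interpolatesB n (J : {set 'I_n}) x G H : separates J x ->
  nodal_poly J x %| G - 1 -> nodal_poly (~: J)%SET x %| G ->
  nodal_poly J x %| H - 1 -> nodal_poly (~: J)%SET x %| H ->
  nodal_poly [set: 'I_n]%SET x %| G - H.
Proof.
move=> sx aG bG aH bH.
rewrite -(nodal_polyM J) Gauss_dvdp; last exact: coprimep_nodal_poly.
apply/andP; split; last exact: dvdp_sub.
rewrite (_ : G - H = (G - 1) - (H - 1)); last by ring.
exact: dvdp_sub.
Qed.

Lemma interpolates_unique n (J : {set 'I_n}) x G H : separates J x ->
  interpolates J x G -> interpolates J x H -> G = H.
Proof.
move=> sx /and3P[sG aG bG] /and3P[sH aH bH].
have D := dvdp_interpolatesB sx aG bG aH bH.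
apply/eqP; rewrite -subr_eq0; apply: contraT => GH.
have := dvdp_leq GH D; rewrite size_nodal_poly cardsT card_ord ltnNge.
by rewrite (leq_trans (size_polyD _ _))// size_polyN geq_max sG sH.
Qed.

Lemma interp_divdiffE n (J : {set 'I_n}) x H : separates J x ->
  interpolates J x H -> interp_divdiff J x = H`_n.-1.
Proof.
move=> sx iH; rewrite /interp_divdiff; case: xgetP => [G _ iG|/(_ H)//].
by rewrite (interpolates_unique sx iG iH).
Qed.

Lemma interpolates_lift n (J : {set 'I_n.+1}) x i G H : separates J x ->
  interpolates J x H -> interpolates (lift_set i J) (col' i x) G ->
  H - G = H`_n *: nodal_poly [set: 'I_n]%SET (col' i x).
Proof.
move=> sx /and3P[sH aH bH] /and3P[sG aG bG].
have D : nodal_poly [set: 'I_n]%SET (col' i x) %| H - G.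
  apply: (dvdp_interpolatesB (separates_lift sx)) => //.
    exact: dvdp_trans (dvdp_nodal_poly_lift _ _ _) aH.
  rewrite -lift_setC; exact: dvdp_trans (dvdp_nodal_poly_lift _ _ _) bH.
set N := nodal_poly _ _ in D *.
have sN : size N = n.+1 by rewrite size_nodal_poly cardsT card_ord.
have mN : N`_n = 1.
  by have /monicP := monic_nodal_poly [set: 'I_n]%SET (col' i x); rewrite /lead_coef sN.
have [c HG] : exists c : F, H - G = c *: N.
  have /dvdpP[q qE] := D.
  have : (size q <= 1)%N.
    have [->|q0] := eqVneq q 0; first by rewrite size_poly0.
    have N0 : N != 0 by rewrite -size_poly_eq0 sN.
    have := size_polyD H (- G); rewrite qE size_polyN size_mul// sN addnS/=.
    rewrite leq_max => /orP[] h.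
      by rewrite -(leq_add2r n) add1n (leq_trans h).
    by rewrite -(leq_add2r n) add1n (leq_trans h)// ltnW// ltnS.
  by move=> /size1_polyC qC; exists q`_0; rewrite qE {1}qC mul_polyC.
have : (H - G)`_n = c by rewrite HG coefZ mN mulr1.
by rewrite coefB (nth_default _ sG) subr0 => ->.
Qed.

(* [H - G] is the leading coefficient of [H] times a monic polynomial for the
   interpolation polynomials [G] with node [i] or [j] removed; multiplying by
   ['X - x_i], resp. ['X - x_j], gives the same polynomial. *)
Lemma interp_divdiff_rec n (J : {set 'I_n.+2}) x i j : separates J x ->
  x 0 i != x 0 j ->
  interp_divdiff J x = (x 0 i - x 0 j)^-1 *
   (interp_divdiff (lift_set j J) (col' j x) -
    interp_divdiff (lift_set i J) (col' i x)).
Proof.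
move=> sx xij.
have [H iH] := interpolates_exists sx.
have [Gi iGi] := interpolates_exists (separates_lift (j := i) sx).
have [Gj iGj] := interpolates_exists (separates_lift (j := j) sx).
rewrite (interp_divdiffE sx iH) (interp_divdiffE (separates_lift sx) iGi).
rewrite (interp_divdiffE (separates_lift sx) iGj)/=.
have Hi := interpolates_lift sx iH iGi; have Hj := interpolates_lift sx iH iGj.
have Tx k : nodal_poly [set: 'I_n.+2]%SET x =
    ('X - (x 0 k)%:P) * nodal_poly [set: 'I_n.+1]%SET (col' k x).
  by rewrite (nodal_poly_lift (j := k)) ?inE// lift_setT.
have E : ('X - (x 0 i)%:P) * (H - Gi) = ('X - (x 0 j)%:P) * (H - Gj).
  by rewrite Hi Hj -!scalerAr -!Tx.
(* In degree [n.+1], [Gi] and [Gj] contribute only through their coefficients of degree [n], which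
   are the two lower divided differences. *)
move/(congr1 (fun p : {poly F} => p`_n.+1)): E.
rewrite !mulrBl !coefB !coefXM !coefCM !coefB/=.
move: iGi iGj => /and3P[sGi _ _] /and3P[sGj _ _].
rewrite (nth_default _ sGi) (nth_default _ sGj) !subr0 => E.
have -> : Gj`_n - Gi`_n = (x 0 i - x 0 j) * H`_n.+1.
  move: E; move: (H`_n) (H`_n.+1) (Gi`_n) (Gj`_n) (x 0 i) (x 0 j).
  move=> a b c d u v E; have -> : d = a - v * b - (a - d - v * b) by ring.
  by rewrite -E; ring.
by rewrite mulKf// subr_eq0.
Qed.

Lemma interp_divdiff0 n (x : 'rV[F]_n) : interp_divdiff (finset.set0 : {set 'I_n}) x = 0.
Proof.
rewrite (@interp_divdiffE _ _ _ 0) ?coef0//.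
  by move=> i j; rewrite inE.
apply/and3P; split; rewrite ?size_poly0 ?dvdp0//.
by rewrite /nodal_poly big_set0 dvd1p.
Qed.

(** Here [H = 1], and its coefficient of degree [n] vanishes unless there is a single node. *)
Lemma interp_divdiffT n (x : 'rV[F]_n.+1) :
  interp_divdiff [set: 'I_n.+1]%SET x = (n == 0)%:R.
Proof.
rewrite (@interp_divdiffE _ _ _ 1) ?coef1//.
  by move=> i j; rewrite !inE.
apply/and3P; split; rewrite ?size_poly1 ?subrr ?dvdp0//.
by rewrite /nodal_poly finset.setCT big_set0 dvd1p.
Qed.

End indicator_interpolation.

(** * Continuity in the nodes for a fixed set [J] *)

Section continuity.
Context {R : realType}.

Lemma continuous_col' m n j : continuous (col' j : 'M[R]_(m, n) -> 'M[R]_(m, n.-1)).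
Proof.
move=> x A [P Px PA].
have H i k : nbhs x [set y : 'M[R]_(m, n) | P i k (y i (lift j k))].
  by apply: (@coord_continuous R m n i (lift j k) x (P i k)); have := Px i k; rewrite mxE.
have := filter_forall (nbhs_filter x) (fun i => filter_forall (nbhs_filter x) (H i)).
apply: filterS => y Py; apply: PA => i k; rewrite mxE; exact: Py.
Qed.

Lemma continuous_coordB n i j : continuous (fun y : 'rV[R]_n => y 0 i - y 0 j).
Proof.
move=> x; apply: (@cvgB _ _ _ (nbhs x) (nbhs_filter x));
  exact: (@coord_continuous R 1 n 0 _ x).
Qed.

Lemma near_separates n (J : {set 'I_n}) (x : 'rV[R]_n) : separates J x ->
  \forall y \near x, separates J y.
Proof.
move=> sx.
have H i j : nbhs x [set y : 'rV[R]_n |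
    i \in J -> j \notin J -> y 0 i != y 0 j].
  have [iJ|iJ] := boolP (i \in J); last by apply: (@filterE _ (nbhs x)).
  have [jJ|jJ] := boolP (j \notin J); last by apply: (@filterE _ (nbhs x)).
  have : nbhs x [set y : 'rV[R]_n | y 0 i - y 0 j != 0].
    have c : (y : 'rV[R]_n) 0 i - y 0 j @[y --> x] --> x 0 i - x 0 j.
      exact: continuous_coordB.
    apply: (c [set z | z != 0]); apply: open_nbhs_nbhs; split; first exact: open_neq.
    by rewrite /= subr_eq0; exact: sx.
  by apply: filterS => y; rewrite /= subr_eq0.
have := filter_forall (nbhs_filter x) (fun i => filter_forall (nbhs_filter x) (H i)).
by apply: filterS => y Hy i j; exact: Hy.
Qed.

(** Induction on the number of nodes. If [J] is neither empty nor full, the recursion applies to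
    some [i] in [J] and [j] outside it. The denominator is nonzero at [x], and the recursion remains
    valid nearby because separation is an open condition. In the two extreme cases the function is
    constant. *)
Lemma interp_divdiff_continuous n (J : {set 'I_n.+1}) (x : 'rV[R]_n.+1) :
  separates J x -> interp_divdiff J y @[y --> x] --> (interp_divdiff J x : R).
Proof.
have C m (K : {set 'I_m}) (z : 'rV[R]_m) (c : R) :
    (forall y, interp_divdiff K y = c) ->
    interp_divdiff K y @[y --> z] --> (interp_divdiff K z : R).
  move=> Kc; rewrite Kc (_ : interp_divdiff K = cst c); last exact/funext.
  exact: (@cvg_cst _ _ _ (nbhs z) (nbhs_filter z)).
elim: n J x => [|n IH] J x sx.
  have -> : J = if 0 \in J then [set: 'I_1]%SET else finset.set0.
    by apply/setP => k; rewrite (ord1 k); case: ifP; rewrite inE.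
  case: ifP => _; apply: C => y; first exact: interp_divdiffT.
  exact: interp_divdiff0.
have [/fintype.subsetP JT|/fintype.subsetPn[j _ jJ]] :=
    boolP ([set: 'I_n.+2] \subset J)%SET.
  have -> : J = [set: 'I_n.+2]%SET by apply/setP => k; rewrite inE JT ?inE.
  by apply: C => y; exact: interp_divdiffT.
have [->|[i iJ]] := set_0Vmem J; first by apply: C => y; exact: interp_divdiff0.
have : ((y : 'rV[R]_n.+2) 0 i - y 0 j)^-1 * (interp_divdiff (lift_set j J) (col' j y) -
      interp_divdiff (lift_set i J) (col' i y)) @[y --> x] --> interp_divdiff J x.
  rewrite (interp_divdiff_rec sx (sx i j iJ jJ)).
  apply: (@cvgM _ _ (nbhs x) (nbhs_filter x)).
    apply: cvgV; first by rewrite subr_eq0; exact: sx.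
    exact: continuous_coordB.
  apply: (@cvgB _ _ _ (nbhs x) (nbhs_filter x)).
    exact: (cvg_comp _ _ (@continuous_col' 1 _ j x) (IH _ _ (separates_lift sx))).
  exact: (cvg_comp _ _ (@continuous_col' 1 _ i x) (IH _ _ (separates_lift sx))).
apply: cvg_trans; apply: (@near_eq_cvg _ _ (nbhs x) (nbhs_filter x)).
apply: (@filterS _ (nbhs x) _ _ _ _ (near_separates sx)) => y sy.
by rewrite (interp_divdiff_rec sy (sy i j iJ jJ)).
Qed.

End continuity.

(** * Differences of classes that are small in measure *)

Section L0_near.
Context d (T : measurableType d) (R : realType).
Variable mu : {finite_measure set T -> \bar R}.

Lemma L0_classBE (f g : T -> R[i]) (mf : measurable_fun setT f)
    (mg : measurable_fun setT g) :
  {ae mu, forall w, (L0_class mu mf - L0_class mu mg : L0 mu) w = f w - g w}.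
Proof.
have H := L0_DE (L0_class mu mf) (- L0_class mu mg).
have H' : {ae mu, forall w, (- L0_class mu mg : L0 mu) w = - g w}.
  apply: filterS2 (L0_oppE (L0_class mu mg)) (L0_classE mu mg) => w e <-.
  exact: e.
by apply: filterS3 H H' (L0_classE mu mf) => w -> -> ->.
Qed.

(** The chosen representative of the difference can be large only on [M] and on a null set where it
    differs from [f - g]. *)
Lemma L0_ball0_classB k (f g : T -> R[i]) (mf : measurable_fun setT f)
    (mg : measurable_fun setT g) (M : set T) :
  measurable M -> (mu M < (k.+1%:R^-1)%:E)%E ->
  (forall w, ~ M w -> normc (f w - g w) < k.+1%:R^-1) ->
  L0_ball0 k (L0_class mu mf - L0_class mu mg).
Proof.
move=> mM muM fg; rewrite /L0_ball0/=; apply: le_lt_trans muM.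
have [N [mN N0 HN]] := L0_classBE mf mg.
rewrite -(measureU0 mM mN N0); apply: le_measure; rewrite ?inE.
- exact/measurable_normC_ge/measurable_L0.
- exact: measurableU.
move=> w /= hw; case: (pselect (M w)) => [|Mw]; [by left|right].
apply: HN => /= e; move: hw; rewrite e leNgt => /negP; apply; exact: fg.
Qed.

End L0_near.

(** * Smoothness of curves of indicator functions *)

Section indicator_curve.
Context d (T : measurableType d) (R : realType).
Variables (mu : {finite_measure set T -> \bar R}) (A : R -> set T).
Hypothesis mA : forall t, measurable (A t).

Definition hits n (x : 'rV[R]_n) (w : T) : {set 'I_n} :=
  [set j | w \in A (x 0 j)]%SET.

Lemma in_hits n (x : 'rV[R]_n) w j : (j \in hits x w) = (w \in A (x 0 j)).
Proof. exact: finset.in_set. Qed.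

(** Equal nodes have the same set [A]. Hence the interpolation results apply at every [x], on the
    diagonals too. *)
Lemma separates_hits n (x : 'rV[R]_n) w : separates (hits x w) x.
Proof.
by move=> i j; rewrite !in_hits => iA jA; apply: contraNneq jA => <-.
Qed.

Lemma lift_hits n j (x : 'rV[R]_n.+1) w :
  lift_set j (hits x w) = hits (col' j x) w.
Proof. by apply/setP => k; rewrite finset.in_set !in_hits mxE. Qed.

Lemma measurable_hits n (x : 'rV[R]_n) J : measurable [set w | hits x w = J].
Proof.
have -> : [set w | hits x w = J] = \bigcap_(j in [set: 'I_n])
    (if j \in J then A (x 0 j) else ~` A (x 0 j)).
  apply/seteqP; split => [w /= <- j _|w /= Jw].
    by rewrite in_hits; case: ifP => [/set_mem//|wA]; move=> /mem_set; rewrite wA.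
  apply/setP => j; rewrite in_hits; have := Jw j I.
  by case: (j \in J) => [/mem_set//|Aw]; apply/negbTE/negP => /set_mem.
apply: fin_bigcap_measurable => // j _.
by case: ifP => _; [exact: mA|exact: measurableC].
Qed.

(** [hits x] takes finitely many values, each on a measurable set. *)
Lemma measurable_fun_hits d' (U : measurableType d') n (x : 'rV[R]_n)
    (F : {set 'I_n} -> U) : measurable_fun setT (F \o hits x).
Proof.
move=> _ B mB; rewrite setTI.
have -> : (F \o hits x) @^-1` B =
    \bigcup_(J in [set J | B (F J)]) [set w | hits x w = J].
  by apply/seteqP; split => [w Bw|w [J /= BJ wJ]];
    [exists (hits x w)|rewrite /preimage/= wJ].
by apply: fin_bigcup_measurable => // J _; exact: measurable_hits.
Qed.

(** With [n.+1] nodes this represents the divided difference of order [n]. *)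
Definition curve_divdiff n (x : 'rV[R]_n) (w : T) : R[i] :=
  ((interp_divdiff (hits x w) x)%:C)%C.

Lemma measurable_curve_divdiff n (x : 'rV[R]_n) :
  measurable_fun setT (curve_divdiff x).
Proof. exact: (measurable_fun_hits x (fun J => ((interp_divdiff J x)%:C)%C)). Qed.

Definition L0_divdiff n (x : 'rV[R]_n) : L0 mu :=
  L0_class mu (measurable_curve_divdiff x).

(** One exceptional set serves all [t] near [a], so that several nodes can be handled by a finite
    union. *)
Hypothesis small_variation : forall a e, 0 < e -> exists2 M : set T,
  measurable M /\ (mu M < e%:E)%E &
  \forall t \near a, forall w, ~ M w -> A t w <-> A a w.

Lemma hits_near n (x : 'rV[R]_n) e : 0 < e -> exists2 M : set T,
  measurable M /\ (mu M < e%:E)%E &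
  nbhs x [set y | forall w, ~ M w -> hits y w = hits x w].
Proof.
move=> e0.
have [M [mM muM] Mx] : exists2 M : set T, measurable M /\ (mu M < e%:E)%E &
    nbhs x [set y : 'rV[R]_n | forall w, ~ M w ->
      forall j, j \in enum 'I_n -> (A (y 0 j) w <-> A (x 0 j) w)].
  (* Along the list of coordinates, half of [e] is spent on the head and half on the tail. *)
  elim: (enum 'I_n) e e0 => [|j s IH] e e0.
    exists set0; first by rewrite measure0 lte_fin.
    by apply: (@filterE _ (nbhs x)).
  have e2 : 0 < e / 2 by rewrite divr_gt0.
  have [M [mM muM] Ms] := IH _ e2.
  have [N [mN muN] Nj] := small_variation (x 0 j) e2.
  exists (M `|` N).
    split; first exact: measurableU.
    have h : (mu (M `|` N) <= mu M + mu N)%E by exact: measureU2.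
    apply: le_lt_trans h _.
    by rewrite [e]splitr EFinD lteD.
  have := @coord_continuous R 1 n 0 j x _ Nj.
  apply: filterS2 Ms => y My Ny w /not_orP[Mw Nw] i.
  by rewrite inE => /orP[/eqP ->|/(My w Mw)//]; exact: Ny.
exists M => //; apply: filterS Mx => y My w Mw.
apply/setP => j; rewrite !in_hits; apply/idP/idP => /set_mem h;
  by apply/mem_set/(My w Mw j (mem_enum _ j)).
Qed.

Lemma L0_divdiff_continuous n :
  continuous (@L0_divdiff n.+1 : 'rV[R]_n.+1 -> L0 mu).
Proof.
move=> x B [k _ kB].
have k0 : 0 < k.+1%:R^-1 :> R by rewrite invr_gt0 ltr0n.
have [M [mM muM] Mx] := hits_near x k0.
(* Finitely many [J] occur, so one neighbourhood will do for all. Sets that do not separate [x] are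
   harmless, since [hits x w] always separates. *)
have H J : nbhs x [set y : 'rV[R]_n.+1 | separates J x ->
    `|interp_divdiff J y - interp_divdiff J x| < k.+1%:R^-1].
  have [sx|nsx] := pselect (separates J x); last first.
    by apply: (@filterE _ (nbhs x)) => y /nsx.
  have /cvgr_dist_lt/(_ _ k0) := interp_divdiff_continuous sx.
  by apply: filterS => y + _; rewrite distrC.
have := filter_forall (nbhs_filter x) H.
apply: filterS2 Mx => y My Hy; apply: kB => /=.
apply: (L0_ball0_classB _ _ mM muM) => w /My E.
rewrite /curve_divdiff E -rmorphB normc_real; apply: Hy.
exact: separates_hits.
Qed.

Lemma L0_divdiff_next n : is_next_divdiff setT (@L0_divdiff n.+1) (@L0_divdiff n.+2).
Proof.
split; first exact/continuous_subspaceT/L0_divdiff_continuous.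
move=> x _ x01; apply/L0_eqP.
have H := L0_classBE mu (measurable_curve_divdiff (col' 1 x))
  (measurable_curve_divdiff (col' 0 x)).
have HZ := L0_ZE (x 0 0 - x 0 1)^-1 (L0_divdiff (col' 1 x) - L0_divdiff (col' 0 x)).
apply: filterS3 H HZ (L0_classE mu (measurable_curve_divdiff x)) => w H -> ->.
rewrite H /curve_divdiff -rmorphB -rmorphM -!lift_hits.
by rewrite -interp_divdiff_rec//; exact: separates_hits.
Qed.

Definition indicator_curve (t : R) : L0 mu := L0_class mu (measurable_indicC (mA t)).

Lemma divdiff_indicator_curve n :
  divdiff setT indicator_curve n = @L0_divdiff n.+1.
Proof.
elim: n => [|n IH]; apply/funext => x.
  apply/L0_eqP; apply: filterS2 (L0_classE mu (measurable_indicC (mA (x 0 0))))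
    (L0_classE mu (measurable_curve_divdiff x)) => w -> ->.
  rewrite /curve_divdiff indicE.
  have -> : hits x w = if w \in A (x 0 0) then [set: 'I_1]%SET else finset.set0.
    by apply/setP => k; rewrite (ord1 k) in_hits; case: ifP => h; rewrite !finset.inE.
  by case: ifP => _; rewrite (interp_divdiffT, interp_divdiff0).
(* [divdiff] picks some continuous extension; as the space is Hausdorff, it must be [L0_divdiff]. *)
rewrite /= IH; case: xgetP => [g _ gP|/(_ (@L0_divdiff n.+2))]; last first.
  by move/(_ (L0_divdiff_next n)).
apply: (is_next_divdiff_unique openT (@L0_hausdorff _ _ _ mu) gP (L0_divdiff_next n)).
exact: mem_set.
Qed.

Lemma classCinfty_indicator_curve : classCinfty setT indicator_curve.
Proof.
elim=> [|k IH].
  apply: continuous_subspaceT => t B [k _ kB].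
  have k0 : 0 < k.+1%:R^-1 :> R by rewrite invr_gt0 ltr0n.
  have [M [mM muM]] := small_variation t k0.
  apply: filterS => s Ms; apply: kB => /=.
  apply: (L0_ball0_classB _ _ mM muM) => w /Ms [st ts].
  rewrite !indicE (_ : w \in A s = (w \in A t)) ?subrr ?normc0//.
  by apply/idP/idP => /set_mem h; apply/mem_set; [exact: st|exact: ts].
split => //; exists (@L0_divdiff k.+2).
by rewrite divdiff_indicator_curve; exact: L0_divdiff_next.
Qed.

Lemma dderive_indicator_curve t : dderive setT indicator_curve t = 0.
Proof.
rewrite /dderive divdiff_indicator_curve; apply/L0_eqP.
apply: filterS2 (L0_classE mu (measurable_curve_divdiff (const_mx t : 'rV_2)))
  (L0_0E mu) => w -> ->.
rewrite /curve_divdiff.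
have -> : hits (const_mx t) w = if w \in A t then [set: 'I_2]%SET else finset.set0.
  by apply/setP => k; rewrite in_hits mxE; case: ifP => h; rewrite !finset.inE.
by case: ifP => _; rewrite (interp_divdiffT, interp_divdiff0).
Qed.

End indicator_curve.

(** * Gauss measure of strips and rectangles, and the quadrants *)

Section gauss.
Context {R : realType}.

Let dens (x : R) : R := (Num.sqrt pi)^-1 * expR (- x ^+ 2).

Let measurable_dens (D : set R) : measurable_fun D (EFin \o dens).
Proof.
apply/measurable_EFinP; apply: measurable_funM => //.
apply: measurableT_comp => //; apply: measurableT_comp => //.
Qed.

Lemma gauss1_le (A : set R) : measurable A ->
  (gauss1 A <= ((Num.sqrt pi)^-1)%:E * lebesgue_measure A)%E.
Proof.
move=> mA; rewrite /gauss1 -(integral_cst (@lebesgue_measure R) mA).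
apply: ge0_le_integral => //.
- exact: measurable_dens.
- move=> x _; rewrite lee_fin ler_piMr ?invr_ge0 ?sqrtr_ge0//.
  by rewrite -expR0 ler_expR oppr_le0 sqr_ge0.
Qed.

Lemma gauss1_itv_gt0 (a b : R) : a < b -> (0 < gauss1 `]a, b])%E.
Proof.
(* On []a, b]] one has [x ^+ 2 <= a ^+ 2 + b ^+ 2] whatever the signs, so [c] bounds the density
   from below. *)
move=> ab; pose c := (Num.sqrt pi)^-1 * expR (- (a ^+ 2 + b ^+ 2)) :> R.
have c0 : 0 < c by rewrite mulr_gt0 ?expR_gt0// invr_gt0 sqrtr_gt0 pi_gt0.
apply: (@lt_le_trans _ _ (c%:E * lebesgue_measure `]a, b]%classic)%E).
  by rewrite lebesgue_measure_itv/= lte_fin ab -EFinB -EFinM lte_fin mulr_gt0 ?subr_gt0.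
rewrite /gauss1 -(integral_cst (@lebesgue_measure R) (measurable_itv _)).
apply: ge0_le_integral => //.
- by move=> x _; rewrite /= lee_fin ltW.
- exact: measurable_dens.
move=> x; rewrite /= in_itv/= => /andP[ax xb].
rewrite lee_fin ler_pM2l ?invr_gt0 ?sqrtr_gt0 ?pi_gt0// ler_expR lerN2.
have [x0|x0] := leP 0 x; nra.
Qed.

Lemma gauss2_rect (I J : set R) : measurable I -> measurable J ->
  gauss2 [set w : R[i] | I (complex.Re w) /\ J (complex.Im w)] =
  (gauss1 I * gauss1 J)%E.
Proof. by move=> mI mJ; rewrite /gauss2 /pushforward -product_measure1E. Qed.

Lemma measurable_rect (I J : set R) : measurable I -> measurable J ->
  measurable [set w : R[i] | I (complex.Re w) /\ J (complex.Im w)].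
Proof. by move=> mI mJ; exists (I `*` J); [exact: measurableX|rewrite setTI]. Qed.

(** For [t] within [r] of [a], the two quadrants have the same upper edge and differ only in the
    vertical strip of half-width [r] around [a]. *)
Lemma quadrant_small_variation (a e : R) : 0 < e -> exists2 M : set R[i],
  measurable M /\ (gauss2 M < e%:E)%E &
  \forall t \near a, forall w, ~ M w ->
    quadrant (t%:C)%C w <-> quadrant (a%:C)%C w.
Proof.
move=> e0.
pose c := (Num.sqrt pi)^-1 :> R.
have c0 : 0 < c by rewrite invr_gt0 sqrtr_gt0 pi_gt0.
(* The strip has width [2 * r] and the density is at most [c], so its measure is at most [e / 2]. *)
pose r := e / (c * 4).
have r0 : 0 < r by rewrite divr_gt0 ?mulr_gt0.
have mI : measurable (`[a - r, a + r]%classic : set R) by exact: measurable_itv.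
exists [set w | `[a - r, a + r]%classic (complex.Re w) /\ setT (complex.Im w)].
  split; first exact: measurable_rect.
  rewrite gauss2_rect// [X in (_ * X)%E]probability_setT mule1.
  apply: (le_lt_trans (gauss1_le mI)).
  rewrite lebesgue_measure_itv/= lte_fin ifT; last by lra.
  rewrite -EFinB -EFinM lte_fin -/c.
  have -> : c * (a + r - (a - r)) = e / 2 by rewrite /r; field; rewrite gt_eqF.
  by rewrite ltr_pdivrMr// ltr_pMr// ltr1n.
exists r => // t /=; rewrite ltr_distlC => /andP[t1 t2] w.
rewrite in_itv/= /quadrant/= => nw.
have {nw} : ~~ (a - r <= complex.Re w <= a + r) by apply/negP => h; apply: nw.
rewrite negb_and -!ltNge => /orP[] h.
  by split=> -[_ ->]; split => //; lra.
by split=> -[h1 _]; exfalso; lra.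
Qed.

Lemma quadrant_curve_inj : injective (fun x : R => quadrant_curve (x%:C)%C).
Proof.
suff H (x y : R) : x < y -> quadrant_curve (x%:C)%C <> quadrant_curve (y%:C)%C.
  move=> x y xy; case: (ltgtP x y) => // h; first by have := H _ _ h xy.
  by have := H _ _ h (esym xy).
move=> xy E.
(* This rectangle lies in the quadrant of [y], misses that of [x], and has positive measure. *)
pose S := [set w : R[i] | `]x, y]%classic (complex.Re w) /\
  `]-1, 0]%classic (complex.Im w)].
have mS : measurable S by apply: measurable_rect; exact: measurable_itv.
have S0 : (0 < gauss2 S)%E.
  by rewrite gauss2_rect//; apply: mule_gt0; apply: gauss1_itv_gt0; rewrite // ltrN10.
have : (gauss2 (R := R)).-negligible S.
  have := L0_classE (gauss2 (R := R)) (measurable_indicC (measurable_quadrant (x%:C)%C)).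
  rewrite -/(quadrant_curve _) E => Hx.
  have Hy := L0_classE (gauss2 (R := R)) (measurable_indicC (measurable_quadrant (y%:C)%C)).
  have : {ae gauss2 (R := R), forall w, ~ S w}.
    apply: filterS2 Hx Hy => w -> /eqP.
    rewrite !indicE => e [/=]; rewrite !in_itv/= => /andP[xw wy] /andP[_ w0].
    have wNx : (w \in quadrant (x%:C)%C) = false.
      by apply/negbTE/negP => /set_mem[/=]; rewrite leNgt xw.
    have wy' : w \in quadrant (y%:C)%C by apply/mem_set.
    by move: e; rewrite wNx wy' eq_sym oner_eq0.
  by apply: negligibleS => w Sw /(_ Sw).
by move=> /negligibleP => /(_ mS) h; rewrite h ltxx in S0.
Qed.

End gauss.

Theorem corollary1 (R : realType) :
  let g : R -> L0 (gauss2 (R := R)) := fun x => quadrant_curve (x%:C)%C in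
  [/\ injective g,
      classCinfty setT g
    & forall x : R, dderive setT g x = 0].
Proof.
move=> g; pose A (t : R) := quadrant (t%:C)%C.
pose mA t : measurable (A t) := measurable_quadrant (t%:C)%C.
split.
- exact: quadrant_curve_inj.
- apply: (@classCinfty_indicator_curve _ _ _ (gauss2 (R := R)) A mA).
  exact: quadrant_small_variation.
- move=> x; apply: (@dderive_indicator_curve _ _ _ (gauss2 (R := R)) A mA).
  exact: quadrant_small_variation.
Qed.
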